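(* Let $\mathbb{K}$ be a field, $J=J_0\sqcup\overline{J_0}$, $R_j\in\mathbb{K}\langle X_i, i\in I\rangle$ for $j\in J$, and let $\mathbb{A}^{c,J_0}$ be the partial centrification of $\mathbb{A}=\mathbb{K}\langle X_i, i\in I\mid R_j=0, j\in J\rangle$ (defined in the context). Suppose that $\mathbb{H}=\mathbb{K}\langle X_i, i\in I\mid R_j=0, j\in\overline{J_0}\rangle$ is a Hopf algebra with comultiplication $\Delta$ and antipode $S$, let $\pi:\mathbb{H}\to\mathbb{A}^{c,J_0}$ be the natural map, and write $\widetilde{R}_j$ for the image of $R_j$ in $\mathbb{H}$. Suppose that $$\Delta(R)\in\pi^{-1}(\operatorname{Cent}(\mathbb{A}^{c,J_0}))\otimes\pi^{-1}(\operatorname{Cent}(\mathbb{A}^{c,J_0}))$$ for all $R\in\{\widetilde{R}_j\}_{j\in J_0}\subseteq\mathbb{H}$, where $\operatorname{Cent}$ denotes the centre. Suppose also that $S(R)\in\pi^{-1}(\operatorname{Cent}(\mathbb{A}^{c,J_0}))$ for all $R\in\{\widetilde{R}_j\}_{j\in J_0}$. Then the centrification $\mathbb{A}^{c,J_0}$ is a Hopf algebra over $\mathbb{K}$.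
   Context: The partial centrification is $$\mathbb{A}^{c,J_0}=\mathbb{K}\langle X_i, i\in I\mid X_iR_j=R_jX_i,\ (i,j)\in I\times J_0;\ R_j=0,\ j\in\overline{J_0}\rangle ,$$ a quotient algebra of $\mathbb{H}$ via the natural map $\pi$ sending generators to generators. Tensor products are over $\mathbb{K}$. Convention: saying that a quotient algebra of the Hopf algebra $\mathbb{H}$ ''is a Hopf algebra'' means that the Hopf algebra structure of $\mathbb{H}$ descends to it, i.e. the kernel of the quotient map is a Hopf ideal. *)

(* Defs.v *)
From HB Require Import structures.
From mathcomp Require Import all_boot all_algebra.
From mathcomp Require Import finmap boolp classical_sets.
From mathcomp Require Import monalg.

Set Implicit Arguments.
Unset Strict Implicit.
Unset Printing Implicit Defensive.

Import GRing.Theory.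
Local Open Scope classical_set_scope.
Local Open Scope ring_scope.
Local Open Scope quotient_scope.

(* Unital associative algebras in which 1 = 0 is allowed: MathComp's [algType]
   requires 1 != 0, which can fail for an algebra given by a presentation.
   The structure extends [lmodType] only, because Hierarchy-Builder rejects a new
   join of [lmodType] and [pzRingType]; the ring structure is derived from it. *)
HB.mixin Record Lmodule_isPzAlgebra (K : pzRingType) A of GRing.Lmodule K A := {
  pz_one : A;
  pz_mul : A -> A -> A;
  pz_mulA : associative pz_mul;
  pz_mul1l : left_id pz_one pz_mul;
  pz_mul1r : right_id pz_one pz_mul;
  pz_mulDl : left_distributive pz_mul +%R;
  pz_mulDr : right_distributive pz_mul +%R;
  pz_mulAl : forall (a : K) (u v : A), a *: pz_mul u v = pz_mul (a *: u) v;
  pz_mulAr : forall (a : K) (u v : A), a *: pz_mul u v = pz_mul u (a *: v)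
}.

#[short(type="pzAlgType")]
HB.structure Definition PzAlgebra (K : pzRingType) :=
  {A of GRing.Lmodule K A & Lmodule_isPzAlgebra K A}.

#[non_forgetful_inheritance]
HB.instance Definition _ (K : pzRingType) (A : pzAlgType K) :=
  GRing.Zmodule_isPzRing.Build (PzAlgebra.sort A)
    pz_mulA pz_mul1l pz_mul1r pz_mulDl pz_mulDr.

Section PzAlgebraTheory.
Context {K : pzRingType} {A : pzAlgType K}.

Lemma pz_scalerAl (a : K) (u v : A) : a *: (u * v) = (a *: u) * v.
Proof. exact: pz_mulAl. Qed.

Lemma pz_scalerAr (a : K) (u v : A) : a *: (u * v) = u * (a *: v).
Proof. exact: pz_mulAr. Qed.
End PzAlgebraTheory.

Section LinearProp.
Context {K : pzRingType} {U V : lmodType K} (f : U -> V) (lf : linear f).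

Lemma lin0 : f 0 = 0.
Proof. by have := lf (-1) 0 0; rewrite scaler0 addr0 scaleN1r addNr. Qed.

Lemma linD x y : f (x + y) = f x + f y.
Proof. by have := lf 1 x y; rewrite !scale1r. Qed.

Lemma linZ (a : K) x : f (a *: x) = a *: f x.
Proof. by have := lf a x 0; rewrite lin0 !addr0. Qed.

Lemma linB x y : f (x - y) = f x - f y.
Proof. by rewrite linD -scaleN1r linZ scaleN1r. Qed.
End LinearProp.

Section Span.
Context {K : pzRingType} {V : lmodType K}.

Definition subspace (P : set V) : Prop :=
  [/\ P 0, forall x y, P x -> P y -> P (x + y)
    & forall (a : K) x, P x -> P (a *: x)].

Definition span (S : set V) : set V :=
  [set x | forall P : set V, subspace P -> S `<=` P -> P x].

Lemma span_subspace S : subspace (span S).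
Proof.
split=> [P [] //|x y Sx Sy P subP SP|a x Sx P subP SP].
  by case: (subP) => _ PD _; apply: PD; [apply: Sx | apply: Sy].
by case: (subP) => _ _; apply; apply: Sx.
Qed.

Lemma sub_span S : S `<=` span S.
Proof. by move=> x Sx P _; apply. Qed.

Definition span_pred (S : set V) : {pred V} := fun x => `[< span S x >].

Lemma span_predP S x : reflect (span S x) (x \in span_pred S).
Proof. exact: asboolP. Qed.

Lemma span_pred_zmod S : zmod_closed (span_pred S).
Proof.
have [S0 SD SZ] := span_subspace S.
split=> [|x y /span_predP Sx /span_predP Sy]; apply/span_predP => //.
by apply: SD => //; rewrite -scaleN1r; apply: SZ.
Qed.

HB.instance Definition _ S :=
  GRing.isZmodClosed.Build V (span_pred S) (span_pred_zmod S).

Definition lquot (S : set V) : Type := Quotient.quot (span_pred S : zmodClosed V).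
HB.instance Definition _ S := GRing.Zmodule.on (lquot S).

Definition lq (S : set V) (x : V) : lquot S := \pi_(Quotient.quot (span_pred S)) x.
Definition lrepr (S : set V) (x : lquot S) : V := repr x.

Lemma lreprK S : cancel (@lrepr S) (@lq S).
Proof. exact: reprK. Qed.

Lemma lqP S x y : lq S x = lq S y <-> span S (x - y).
Proof.
rewrite /lq; split=> [/eqP|/span_predP]; rewrite -?Quotient.idealrBE.
  by move=> ?; apply/span_predP.
by rewrite Quotient.idealrBE => /eqP.
Qed.

Lemma lqD S : {morph lq S : x y / x + y}.
Proof. exact: Quotient.pi_add. Qed.

Definition lq_scale S (a : K) (x : lquot S) : lquot S := lq S (a *: lrepr x).

Lemma lq_scaleE S a x : lq_scale a (lq S x) = lq S (a *: x).
Proof.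
apply/lqP; rewrite -scalerBr; have [_ _] := span_subspace S; apply.
by apply/lqP; rewrite lreprK.
Qed.

Lemma lq_scaleA S (a b : K) (x : lquot S) :
  lq_scale a (lq_scale b x) = lq_scale (a * b) x.
Proof. by rewrite -[x]lreprK !lq_scaleE scalerA. Qed.
Lemma lq_scale1 S : left_id 1 (@lq_scale S).
Proof. by move=> x; rewrite -[x]lreprK !lq_scaleE scale1r. Qed.
Lemma lq_scaleDr S : right_distributive (@lq_scale S) +%R.
Proof.
by move=> a x y; rewrite -[x]lreprK -[y]lreprK -lqD !lq_scaleE scalerDr lqD.
Qed.
Lemma lq_scaleDl S (x : lquot S) : {morph (@lq_scale S)^~ x : a b / a + b}.
Proof. by move=> a b; rewrite -[x]lreprK !lq_scaleE scalerDl lqD. Qed.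

HB.instance Definition _ S := GRing.Zmodule_isLmodule.Build K (lquot S)
  (@lq_scaleA S) (@lq_scale1 S) (@lq_scaleDr S) (@lq_scaleDl S).

Lemma lqZ S (a : K) x : lq S (a *: x) = a *: lq S x.
Proof. by rewrite -lq_scaleE. Qed.

Lemma lq_eq0 S x : lq S x = 0 <-> span S x.
Proof.
have <- : lq S 0 = 0.
  by have := lqZ S 0 (0 : V); rewrite !scale0r.
by rewrite lqP subr0.
Qed.
End Span.

Section TwoSidedIdeals.
Context {K : pzRingType} {A : pzAlgType K}.

Definition two_sided_ideal (P : set A) : Prop :=
  [/\ subspace P, forall a x, P x -> P (a * x) & forall a x, P x -> P (x * a)].

Definition two_sided_mults (S : set A) : set A :=
  [set x | exists a r b, S r /\ x = a * r * b].

Definition ideal_gen (S : set A) : set A := span (two_sided_mults S).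

Lemma ideal_gen_ideal S : two_sided_ideal (ideal_gen S).
Proof.
split; first exact: span_subspace.
- move=> a x Sx.
  apply: (Sx [set y | ideal_gen S (a * y)]) => [|_ [b [r [c [Sr ->]]]]] /=.
    have [S0 SD SZ] := span_subspace (two_sided_mults S).
    split=> /= [|y z ? ?|k y ?]; rewrite ?mulr0 ?mulrDr -?pz_scalerAr //.
      exact: SD.
    exact: SZ.
  by apply: sub_span; exists (a * b), r, c; rewrite !mulrA.
- move=> a x Sx.
  apply: (Sx [set y | ideal_gen S (y * a)]) => [|_ [b [r [c [Sr ->]]]]] /=.
    have [S0 SD SZ] := span_subspace (two_sided_mults S).
    split=> /= [|y z ? ?|k y ?]; rewrite ?mul0r ?mulrDl -?pz_scalerAl //.
      exact: SD.
    exact: SZ.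
  by apply: sub_span; exists b, r, (c * a); rewrite !mulrA.
Qed.

Lemma sub_ideal_gen S : S `<=` ideal_gen S.
Proof. by move=> x Sx; apply: sub_span; exists 1, x, 1; rewrite mul1r mulr1. Qed.

Lemma ideal_gen_min S P : two_sided_ideal P -> S `<=` P -> ideal_gen S `<=` P.
Proof.
move=> [subP Pl Pr] SP x; apply=> // _ [a [r [b [Sr ->]]]].
by apply: Pr; apply: Pl; apply: SP.
Qed.

Definition aquot (S : set A) : Type := lquot (two_sided_mults S).
HB.instance Definition _ S := GRing.Lmodule.on (aquot S).

Definition aq (S : set A) (x : A) : aquot S := lq _ x.
Definition arepr (S : set A) (x : aquot S) : A := lrepr x.

Lemma areprK S : cancel (@arepr S) (@aq S).
Proof. exact: lreprK. Qed.

Lemma aqP S x y : aq S x = aq S y <-> ideal_gen S (x - y).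
Proof. exact: lqP. Qed.

Lemma aq_eq0 S x : aq S x = 0 <-> ideal_gen S x.
Proof. exact: lq_eq0. Qed.

Lemma aqD S : {morph aq S : x y / x + y}.
Proof. exact: lqD. Qed.

Lemma aqZ S (a : K) x : aq S (a *: x) = a *: aq S x.
Proof. exact: lqZ. Qed.

Definition aq_mul S (x y : aquot S) : aquot S := aq S (arepr x * arepr y).

Lemma aq_mulE S x y : aq_mul (aq S x) (aq S y) = aq S (x * y).
Proof.
have [[_ SD _] Sl Sr] := ideal_gen_ideal S.
apply/aqP; set x' := arepr _; set y' := arepr _.
have -> : x' * y' - x * y = x' * (y' - y) + (x' - x) * y.
  by rewrite mulrBr mulrBl addrA subrK.
by apply: SD; [apply: Sl | apply: Sr]; apply/aqP; rewrite areprK.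
Qed.

Lemma aq_mulA S : associative (@aq_mul S).
Proof.
by move=> x y z; rewrite -[x]areprK -[y]areprK -[z]areprK !aq_mulE mulrA.
Qed.
Lemma aq_mul1l S : left_id (aq S 1) (@aq_mul S).
Proof. by move=> x; rewrite -[x]areprK aq_mulE mul1r. Qed.
Lemma aq_mul1r S : right_id (aq S 1) (@aq_mul S).
Proof. by move=> x; rewrite -[x]areprK aq_mulE mulr1. Qed.
Lemma aq_mulDl S : left_distributive (@aq_mul S) +%R.
Proof.
move=> x y z; rewrite -[x]areprK -[y]areprK -[z]areprK.
by rewrite -aqD !aq_mulE mulrDl aqD.
Qed.
Lemma aq_mulDr S : right_distributive (@aq_mul S) +%R.
Proof.
move=> x y z; rewrite -[x]areprK -[y]areprK -[z]areprK.
by rewrite -aqD !aq_mulE mulrDr aqD.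
Qed.

Lemma aq_mulAl S (a : K) (u v : aquot S) : a *: aq_mul u v = aq_mul (a *: u) v.
Proof.
by rewrite -[u]areprK -[v]areprK aq_mulE -!aqZ aq_mulE pz_scalerAl.
Qed.
Lemma aq_mulAr S (a : K) (u v : aquot S) : a *: aq_mul u v = aq_mul u (a *: v).
Proof.
by rewrite -[u]areprK -[v]areprK aq_mulE -!aqZ aq_mulE pz_scalerAr.
Qed.

HB.instance Definition _ S := Lmodule_isPzAlgebra.Build K (aquot S)
  (@aq_mulA S) (@aq_mul1l S) (@aq_mul1r S) (@aq_mulDl S) (@aq_mulDr S)
  (@aq_mulAl S) (@aq_mulAr S).
HB.instance Definition _ S :=
  GRing.PzRing.copy (aquot S) (PzAlgebra.sort (aquot S : pzAlgType K)).

Lemma aqM S : {morph aq S : x y / x * y}.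
Proof. by move=> x y; rewrite -aq_mulE. Qed.

Lemma aq1 S : aq S 1 = 1.
Proof. by []. Qed.

(* Only meaningful when [ideal_gen S `<=` ideal_gen T]; see [aq_mapE]. *)
Definition aq_map (S T : set A) (x : aquot S) : aquot T := aq T (arepr x).

Lemma aq_mapE S T x : S `<=` ideal_gen T -> aq_map T (aq S x) = aq T x.
Proof.
move=> ST; apply/aqP; apply: (ideal_gen_min (ideal_gen_ideal T) ST).
by apply/aqP; rewrite areprK.
Qed.

Lemma aq_map_linear S T : S `<=` ideal_gen T -> linear (@aq_map S T).
Proof.
move=> ST a x y; rewrite -[x]areprK -[y]areprK -aqZ -aqD !aq_mapE //.
by rewrite aqD aqZ.
Qed.

Lemma aq_map_monoid S T : S `<=` ideal_gen T -> monoid_morphism (@aq_map S T).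
Proof.
move=> ST; split=> [|x y]; first by rewrite -!aq1 aq_mapE.
by rewrite -[x]areprK -[y]areprK -aqM !aq_mapE // aqM.
Qed.

Definition center : set A := [set z | forall x, GRing.comm z x].
End TwoSidedIdeals.

Section Tensor.
Context {K : comNzRingType}.

Definition bilinear_map (V W U : lmodType K) (f : V -> W -> U) : Prop :=
  (forall w, linear (f^~ w)) /\ (forall v, linear (f v)).

Lemma linear_comb (U V : lmodType K) (f g : U -> V) (k : K) :
  linear f -> linear g -> linear (fun x => k *: f x + g x).
Proof.
move=> lf lg a x y; rewrite lf lg !scalerDr !scalerA [k * a]mulrC.
by rewrite -!addrA; congr (_ + _); rewrite addrCA.
Qed.

Lemma linear_comp (U V W : lmodType K) (f : V -> W) (g : U -> V) :
  linear f -> linear g -> linear (f \o g).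
Proof. by move=> lf lg a x y /=; rewrite lg lf. Qed.

Lemma linear_id (U : lmodType K) : linear (@id U).
Proof. by []. Qed.

Section TensorProduct.
Context (V W : lmodType K).
Local Notation M := {malg K[(V * W)%type]}.
Local Notation "<< v , w >>" := (mkmalgU (v, w) 1 : M).

Definition tensor_rels : set M :=
  [set x | (exists a v v' w, x = << a *: v + v', w >> - (a *: << v, w >> + << v', w >>))
        \/ (exists a v w w', x = << v, a *: w + w' >> - (a *: << v, w >> + << v, w' >>))].

Definition tensor : Type := lquot tensor_rels.
HB.instance Definition _ := GRing.Lmodule.on tensor.

Definition tens (v : V) (w : W) : tensor := lq tensor_rels << v, w >>.

Lemma tens_bilinear : bilinear_map tens.
Proof.
split=> [w a v v'|v a w w']; rewrite /tens -lqZ -lqD; apply/lqP; apply: sub_span.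
  by left; exists a, v, v', w.
by right; exists a, v, w, w'.
Qed.


Lemma tensor_ind (P : tensor -> Prop) :
  subspace P -> (forall v w, P (tens v w)) -> forall t, P t.
Proof.
move=> [P0 PD PZ] Pt t; rewrite -[t]lreprK; set g := lrepr t.
have lq_add (x y : M) :
  lq tensor_rels (x + y) = lq tensor_rels x + lq tensor_rels y by exact: lqD.
rewrite [g]monalgE; elim: (enum_fset (msupp g)) => [|[v w] s IHs].
  by rewrite big_nil; have -> : lq tensor_rels 0 = 0 by apply/lq_eq0; case: (span_subspace tensor_rels).
rewrite big_cons lq_add; apply: PD => //.
have -> : << g@_(v, w) *g (v, w) >> = g@_(v, w) *: << v, w >>.
  by apply/malgP=> k; rewrite mcoeffZ !mcoeffU mulr_natr.
by rewrite lqZ; apply: PZ; apply: Pt.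
Qed.

Lemma eq_tensor (U : lmodType K) (f g : tensor -> U) : linear f -> linear g ->
  (forall a b, f (tens a b) = g (tens a b)) -> f =1 g.
Proof.
move=> lf lg fg.
apply: tensor_ind => //; split=> /= [|x y fx fy|k x fx].
- by rewrite (lin0 lf) (lin0 lg).
- by rewrite (linD lf) (linD lg) fx fy.
- by rewrite (linZ lf) (linZ lg) fx.
Qed.

Section Lift.
Context (U : lmodType K) (f : V -> W -> U).

Definition mlift (g : M) : U :=
  \sum_(p <- msupp g) g@_p *: f p.1 p.2.

(* The linear map on [tensor] induced by a bilinear [f]; see [tlift_tens] and
   [tlift_linear]. Junk when [f] is not bilinear. *)
Definition tlift (t : tensor) : U := mlift (lrepr t).

Lemma mliftEw (d : {fset (V * W)%type}) g : (msupp g `<=` d)%fset ->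
  mlift g = \sum_(p <- d) g@_p *: f p.1 p.2.
Proof.
move=> le; rewrite /mlift (big_fset_incl _ le) => //= p _ /mcoeff_outdom ->.
by rewrite scale0r.
Qed.

Lemma mlift_linear : linear mlift.
Proof.
move=> a g h; pose d := (msupp g `|` msupp h `|` msupp (a *: g + h))%fset.
rewrite !(@mliftEw d) /d ?fsubsetUr // -?fsetUA ?fsubsetUl //; last first.
  by rewrite fsetUCA fsubsetUl.
rewrite scaler_sumr -big_split /=; apply: eq_bigr => p _.
by rewrite mcoeffD mcoeffZ scalerDl scalerA.
Qed.

Lemma mliftU v w : mlift << v, w >> = f v w.
Proof.
by rewrite (mliftEw msuppU_le) big_seq_fset1 mcoeffUU scale1r.
Qed.

Hypothesis bil_f : bilinear_map f.

Lemma tlift_lq g : tlift (lq tensor_rels g) = mlift g.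
Proof.
have : span tensor_rels (lrepr (lq tensor_rels g) - g).
  by apply/lqP; rewrite lreprK.
have [fl fr] := bil_f; have lm := mlift_linear.
move=> /(_ [set x | mlift x = 0]) /= E.
apply/eqP; rewrite -subr_eq0 /tlift -(linB lm); apply/eqP/E => [|x /=].
  split=> /= [|x y Fx Fy|a x Fx]; first exact: lin0.
    by rewrite (linD lm) Fx Fy addr0.
  by rewrite (linZ lm) Fx scaler0.
case=> -[a [v [v' [w ->]]]]; rewrite (linB lm) (linD lm) (linZ lm) !mliftU.
  by rewrite (fl w) subrr.
by rewrite (fr v) subrr.
Qed.

Lemma tlift_tens v w : tlift (tens v w) = f v w.
Proof. by rewrite tlift_lq mliftU. Qed.

Lemma tlift_linear : linear tlift.
Proof.
move=> a x y; rewrite -[x]lreprK -[y]lreprK -lqZ -lqD !tlift_lq.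
exact: mlift_linear.
Qed.
End Lift.
End TensorProduct.

(* For subspaces [P] and [Q] of vector spaces, this is the image of
   [P \otimes Q], which injects into the tensor product over a field. *)
Definition tensor_sub (V W : lmodType K) (P : set V) (Q : set W) :
    set (tensor V W) :=
  span [set t | exists v w, [/\ P v, Q w & t = tens v w]].

Definition tensor_map (V V' W W' : lmodType K) (f : V -> V') (g : W -> W') :
    tensor V W -> tensor V' W' :=
  tlift (fun v w => tens (f v) (g w)).

Lemma tensor_map_bilinear (V V' W W' : lmodType K) (f : V -> V') (g : W -> W') :
  linear f -> linear g -> bilinear_map (fun v w => tens (f v) (g w)).
Proof.
move=> lf lg; have [tl tr] := tens_bilinear V' W'.
by split=> [w a v v'|v a w w'] /=; rewrite ?lf ?lg ?tl ?tr.
Qed.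

Definition tensor_assoc (U V W : lmodType K) :
    tensor (tensor U V) W -> tensor U (tensor V W) :=
  tlift (fun t w => tlift (fun u v => tens u (tens v w)) t).

Lemma tensor_assocE (U V W : lmodType K) (u : U) (v : V) (w : W) :
  tensor_assoc (tens (tens u v) w) = tens u (tens v w).
Proof.
have tl (X Y : lmodType K) := (tens_bilinear X Y).1.
have tr (X Y : lmodType K) := (tens_bilinear X Y).2.
have bil w0 : bilinear_map (fun (u : U) (v : V) => tens u (tens v (w0 : W))).
  split=> [v0 a u0 u1|u0 a v0 v1] /=; first exact: tl.
  by rewrite tl tr.
rewrite /tensor_assoc; set h := (fun _ _ => _).
have lh w0 : linear (h^~ w0) by apply: tlift_linear; apply: bil.
have hE u0 v0 w0 : h (tens u0 v0) w0 = tens u0 (tens v0 w0).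
  by apply: tlift_tens; apply: bil.
rewrite tlift_tens ?hE //; split=> // t a w0 w1; move: t.
apply: eq_tensor; [exact: lh|by apply: linear_comb; apply: lh|].
by move=> u0 v0; rewrite !hE tr tr.
Qed.

Section TensorAlgebra.
Context (A B : pzAlgType K).
Local Notation T := (tensor A B).

Definition tensor_mull (a : A) (b : B) : T -> T :=
  tlift (fun a' b' => tens (a * a') (b * b')).

Definition tensor_one : T := tens (1 : A) (1 : B).

(* (a \otimes b) * (a' \otimes b') = (a * a') \otimes (b * b'), see [tensM] *)
Definition tensor_mul (x y : T) : T := tlift (fun a b => tensor_mull a b y) x.

Let tl := (tens_bilinear A B).1.
Let tr := (tens_bilinear A B).2.

Lemma mull_linear (R : pzAlgType K) (a : R) : linear ( *%R a).
Proof. by move=> k x y; rewrite mulrDr pz_scalerAr. Qed.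

Lemma tensor_mull_bil (a : A) (b : B) :
  bilinear_map (fun a' b' => tens (a * a') (b * b')).
Proof. by apply: tensor_map_bilinear; apply: mull_linear. Qed.

Lemma tensor_mullE a b a' b' :
  tensor_mull a b (tens a' b') = tens (a * a') (b * b').
Proof. by rewrite /tensor_mull tlift_tens //; apply: tensor_mull_bil. Qed.

Lemma tensor_mull_linear a b : linear (tensor_mull a b).
Proof. exact: tlift_linear (tensor_mull_bil a b). Qed.

Lemma tensor_mul_bil y : bilinear_map (fun a b => tensor_mull a b y).
Proof.
split=> [b k a a'|a k b b'].
  move: y; apply: eq_tensor; [exact: tensor_mull_linear| |].
    by apply: linear_comb; apply: tensor_mull_linear.
  by move=> a0 b0; rewrite !tensor_mullE mulrDl -pz_scalerAl tl.
move: y; apply: eq_tensor; [exact: tensor_mull_linear| |].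
  by apply: linear_comb; apply: tensor_mull_linear.
by move=> a0 b0; rewrite !tensor_mullE mulrDl -pz_scalerAl tr.
Qed.

Lemma tensor_mul_linl y : linear (tensor_mul^~ y).
Proof. exact: tlift_linear (tensor_mul_bil y). Qed.

Lemma tensor_mul_tens a b y : tensor_mul (tens a b) y = tensor_mull a b y.
Proof. by rewrite /tensor_mul tlift_tens //; apply: tensor_mul_bil. Qed.

Lemma tensor_mul_linr x : linear (tensor_mul x).
Proof.
move=> k y z; move: x; apply: eq_tensor; first exact: tensor_mul_linl.
  by apply: linear_comb; apply: tensor_mul_linl.
by move=> a b; rewrite !tensor_mul_tens tensor_mull_linear.
Qed.

Lemma tensor_mulA : associative tensor_mul.
Proof.
move=> x y z; move: x; apply: eq_tensor.
- exact: tensor_mul_linl.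
- exact: (linear_comp (tensor_mul_linl z) (tensor_mul_linl y)).
move=> a b; move: y; apply: eq_tensor.
- exact: (linear_comp (tensor_mul_linr _) (tensor_mul_linl z)).
- exact: (linear_comp (tensor_mul_linl z) (tensor_mul_linr _)).
move=> a' b'; move: z; apply: eq_tensor.
- exact: (linear_comp (tensor_mul_linr _) (tensor_mul_linr _)).
- exact: tensor_mul_linr.
by move=> a0 b0; rewrite !(tensor_mul_tens, tensor_mullE) !mulrA.
Qed.

Lemma tensor_mul1l : left_id tensor_one tensor_mul.
Proof.
apply: (@eq_tensor A B T); [exact: tensor_mul_linr|exact: linear_id|].
by move=> a b; rewrite tensor_mul_tens tensor_mullE !mul1r.
Qed.

Lemma tensor_mul1r : right_id tensor_one tensor_mul.
Proof.
apply: (@eq_tensor A B T (tensor_mul^~ tensor_one)).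
- exact: tensor_mul_linl.
- exact: linear_id.
by move=> a b; rewrite tensor_mul_tens tensor_mullE !mulr1.
Qed.

Lemma tensor_mulDl : left_distributive tensor_mul +%R.
Proof. by move=> x y z; exact: linD (tensor_mul_linl z) _ _. Qed.

Lemma tensor_mulDr : right_distributive tensor_mul +%R.
Proof. by move=> x y z; exact: linD (tensor_mul_linr x) _ _. Qed.

Lemma tensor_mulAl (k : K) (u v : T) :
  k *: tensor_mul u v = tensor_mul (k *: u) v.
Proof. by rewrite (linZ (tensor_mul_linl v)). Qed.

Lemma tensor_mulAr (k : K) (u v : T) :
  k *: tensor_mul u v = tensor_mul u (k *: v).
Proof. by rewrite (linZ (tensor_mul_linr u)). Qed.

HB.instance Definition _ := Lmodule_isPzAlgebra.Build K (tensor A B)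
  tensor_mulA tensor_mul1l tensor_mul1r tensor_mulDl tensor_mulDr
  tensor_mulAl tensor_mulAr.
HB.instance Definition _ :=
  GRing.PzRing.copy (tensor A B) (PzAlgebra.sort (tensor A B : pzAlgType K)).

Lemma tensM (a a' : A) (b b' : B) :
  tens a b * tens a' b' = tens (a * a') (b * b').
Proof. by rewrite -tensor_mullE -tensor_mul_tens. Qed.
End TensorAlgebra.
End Tensor.

Section Hopf.
Context {K : comNzRingType} {H : pzAlgType K}.

Record is_hopf (Delta : H -> tensor H H) (eps : H -> K) (S : H -> H) : Prop := {
  comul_linear : linear Delta;
  comul_monoid : monoid_morphism Delta;
  counit_linear : scalar eps;
  counit_monoid : monoid_morphism eps;
  coassociative : forall x,
    tensor_assoc (tensor_map Delta id (Delta x)) = tensor_map id Delta (Delta x);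
  counitl : forall x, tlift (fun y z : H => eps y *: z) (Delta x) = x;
  counitr : forall x, tlift (fun y z : H => eps z *: y) (Delta x) = x;
  antipode_linear : linear S;
  antipodel : forall x, tlift (fun y z : H => S y * z) (Delta x) = eps x *: (1 : H);
  antipoder : forall x, tlift (fun y z : H => y * S z) (Delta x) = eps x *: (1 : H)
}.

Record is_hopf_ideal (Delta : H -> tensor H H) (eps : H -> K) (S : H -> H)
    (P : set H) : Prop := {
  hopf_ideal_two_sided : two_sided_ideal P;
  hopf_ideal_comul : forall x, P x ->
    exists u v, [/\ tensor_sub P setT u, tensor_sub setT P v & Delta x = u + v];
  hopf_ideal_counit : forall x, P x -> eps x = 0;
  hopf_ideal_antipode : forall x, P x -> P (S x)
}.
End Hopf.

Section Presentations.
Context {K : comNzRingType} {I : choiceType}.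

Definition free_alg : Type := {malg K[{fmonom I}]}.
HB.instance Definition _ := GRing.Lmodule.on free_alg.

Lemma malg_scalerAr (k : K) (x y : {malg K[{fmonom I}]}) :
  k *: (x * y) = x * (k *: y).
Proof.
apply/malgP => m; rewrite mcoeffZ.
rewrite !(@mcoeffMlw _ _ (msupp x) (msupp y)) ?fsubset_refl ?msuppZ_le //.
rewrite mulr_sumr; apply: eq_bigr => p _; rewrite mulr_sumr.
by apply: eq_bigr => q _; rewrite mcoeffZ -mulrnAr mulrCA -!mulrnAr.
Qed.

HB.instance Definition _ := Lmodule_isPzAlgebra.Build K free_alg
  (@mulrA {malg K[{fmonom I}]}) (@mul1r _) (@mulr1 _) (@mulrDl _) (@mulrDr _)
  (@scalerAl K {malg K[{fmonom I}]}) malg_scalerAr.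
HB.instance Definition _ :=
  GRing.PzRing.copy free_alg (PzAlgebra.sort (free_alg : pzAlgType K)).

Definition gen (i : I) : free_alg := mkmalgU (fmu i) 1.

Context {J : Type} (J0 : set J) (R : J -> free_alg).

Definition hopf_relators : set free_alg := R @` (~` J0).

Definition centrification_relators : set free_alg :=
  [set x | exists i j, J0 j /\ x = gen i * R j - R j * gen i] `|` hopf_relators.

Lemma hopf_relators_sub : hopf_relators `<=` ideal_gen centrification_relators.
Proof. by move=> x Rx; apply: sub_ideal_gen; right. Qed.

Definition centrification_map :
    aquot hopf_relators -> aquot centrification_relators :=
  @aq_map _ _ hopf_relators centrification_relators.

Lemma centrification_map_aq x :
  centrification_map (aq hopf_relators x) = aq centrification_relators x.
Proof. exact: aq_mapE hopf_relators_sub. Qed.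

Lemma centrification_map_linear : linear centrification_map.
Proof. exact: aq_map_linear hopf_relators_sub. Qed.

Lemma centrification_map_monoid : monoid_morphism centrification_map.
Proof. exact: aq_map_monoid hopf_relators_sub. Qed.
End Presentations.

Arguments free_alg : clear implicits.
Arguments hopf_relators {K I J} J0 R.
Arguments centrification_relators {K I J} J0 R.
Arguments centrification_map {K I J} J0 R x.

Notation base_alg J0 R := (aquot (hopf_relators J0 R)).
Notation partial_centrification J0 R := (aquot (centrification_relators J0 R)).

(* Main.v *)
Require Import Defs.
From mathcomp Require Import all_boot all_algebra.
From mathcomp Require Import boolp classical_sets.

Set Implicit Arguments.
Unset Strict Implicit.
Unset Printing Implicit Defensive.

Import GRing.Theory.
Local Open Scope classical_set_scope.
Local Open Scope ring_scope.

(** The kernel [P] of [pi] is generated by the commutators [[X_i, R_j]].  The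
sets [Delta^-1 (P (x) H + H (x) P)], [ker eps] and [S^-1 P] are two-sided
ideals, so it suffices that they contain these commutators.  For [Delta],
[[x (x) y, c (x) d] = [x, c] (x) y d + c x (x) [y, d]], and both commutators on
the right lie in [P] when [c] and [d] become central under [pi].  For [eps] the
field is commutative; for [S] one uses that it reverses products. *)

(** * Preimages of subspaces and sums of ideals *)

Section LinearSubspaces.
Context {K : pzRingType} {U V : lmodType K}.

Lemma subspace_preimage (f : U -> V) (P : set V) :
  linear f -> subspace P -> subspace (f @^-1` P).
Proof.
move=> lf [P0 PD PZ]; split=> /= [|x y Px Py|a x Px].
- by rewrite (lin0 lf).
- by rewrite (linD lf); apply: PD.
- by rewrite (linZ lf); apply: PZ.
Qed.

Lemma subspace0 : subspace [set 0 : V].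
Proof.
by split=> /= [|x y -> ->|a x ->]; rewrite ?addr0 ?scaler0.
Qed.
End LinearSubspaces.

Section TwoSidedIdeals.
Context {K : pzRingType} {A : pzAlgType K}.

(** Spelled as the existential of [hopf_ideal_comul], so that membership of [Delta x] in such a sum
    is that clause by conversion. *)
Definition set_sum (P Q : set A) : set A :=
  [set t | exists u v, [/\ P u, Q v & t = u + v]].

Lemma two_sided_ideal_sum (P Q : set A) :
  two_sided_ideal P -> two_sided_ideal Q -> two_sided_ideal (set_sum P Q).
Proof.
move=> [[P0 PD PZ] Pl Pr] [[Q0 QD QZ] Ql Qr]; split; first split.
- by exists 0, 0; rewrite addr0.
- move=> _ _ [u [v [Pu Qv ->]]] [u' [v' [Pu' Qv' ->]]].
  by exists (u + u'), (v + v'); rewrite addrACA; split; [apply: PD|apply: QD|].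
- move=> a _ [u [v [Pu Qv ->]]]; exists (a *: u), (a *: v).
  by rewrite scalerDr; split; [apply: PZ|apply: QZ|].
- move=> a _ [u [v [Pu Qv ->]]]; exists (a * u), (a * v).
  by rewrite mulrDr; split; [apply: Pl|apply: Ql|].
- move=> a _ [u [v [Pu Qv ->]]]; exists (u * a), (v * a).
  by rewrite mulrDl; split; [apply: Pr|apply: Qr|].
Qed.

Lemma mulr_linear (b : A) : linear (fun a : A => a * b).
Proof. by move=> k x y; rewrite mulrDl pz_scalerAl. Qed.

Lemma center_commutator (B : pzAlgType K) (f : A -> B) (c x : A) :
  linear f -> monoid_morphism f -> center (f c) -> f (x * c - c * x) = 0.
Proof. by move=> lf [_ fM] cc; rewrite (linB lf) !fM cc subrr. Qed.
End TwoSidedIdeals.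

(** * Ideals and commutators in a tensor product of algebras *)

Section TensorIdeals.
Context {K : comNzRingType}.

Lemma tensor_sub_ideal (A B : pzAlgType K) (P : set A) (Q : set B) :
  two_sided_ideal P -> two_sided_ideal Q -> two_sided_ideal (tensor_sub P Q).
Proof.
move=> [_ Pl Pr] [_ Ql Qr].
pose pure := [set t | exists a b, [/\ P a, Q b & t = tens a b]].
have subPQ : subspace (tensor_sub P Q) := span_subspace pure.
split=> // s t Pt.
(* Membership in a span is a universal property, so [Pt] serves as an induction principle: it
   reduces [t] to a generator, and [tensor_ind] then reduces [s] to a pure tensor. *)
- apply: (Pt (fun t => tensor_sub P Q (s * t))).
    exact: (subspace_preimage (mull_linear s)).
  move=> _ [a [b [Pa Qb ->]]]; move: s.
  apply: tensor_ind => [|a' b'].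
    exact: (subspace_preimage (@mulr_linear _ _ (tens a b))).
  rewrite tensM; apply: (@Defs.sub_span _ _ pure).
  by exists (a' * a), (b' * b); split; [apply: Pl|apply: Ql|].
- apply: (Pt (fun t => tensor_sub P Q (t * s))).
    exact: (subspace_preimage (@mulr_linear _ _ s)).
  move=> _ [a [b [Pa Qb ->]]]; move: s.
  apply: tensor_ind => [|a' b'].
    exact: (subspace_preimage (mull_linear (tens a b))).
  rewrite tensM; apply: (@Defs.sub_span _ _ pure).
  by exists (a * a'), (b * b'); split; [apply: Pr|apply: Qr|].
Qed.

Lemma tensor_commutator (A : pzAlgType K) (P C : set A) :
  two_sided_ideal P -> (forall c x : A, C c -> P (x * c - c * x)) ->
  forall s t : tensor A A, tensor_sub C C t ->
  set_sum (tensor_sub P setT) (tensor_sub setT P) (s * t - t * s).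
Proof.
move=> idP CP s t Ct; set N := set_sum _ _.
have [subN _ _] : two_sided_ideal N.
  by apply: two_sided_ideal_sum; apply: tensor_sub_ideal.
have lin_l (y : tensor A A) : linear (fun x : tensor A A => y * x - x * y).
  by move=> k x z; rewrite mulrDr mulrDl -pz_scalerAl -pz_scalerAr
    scalerBr opprD addrACA.
have lin_r (y : tensor A A) : linear (fun x : tensor A A => x * y - y * x).
  by move=> k x z; rewrite mulrDr mulrDl -pz_scalerAl -pz_scalerAr
    scalerBr opprD addrACA.
apply: (Ct (fun t => N (s * t - t * s))).
  exact: (subspace_preimage (lin_l s)).
move=> _ [c [d [Cc Cd ->]]]; move: s.
apply: tensor_ind => [|x y]; first exact: (subspace_preimage (lin_r _)).
(* The mixed term [tens (c * x) (y * d)] is subtracted and added back. *)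
exists (tens (x * c - c * x) (y * d)), (tens (c * x) (y * d - d * y)).
have [tl tr] := tens_bilinear A A.
split.
- by apply: Defs.sub_span; exists (x * c - c * x), (y * d); split=> //; apply: CP.
- by apply: Defs.sub_span; exists (c * x), (y * d - d * y); split=> //; apply: CP.
- by rewrite !tensM (linB (tl _)) (linB (tr _)) addrA subrK.
Qed.
End TensorIdeals.

Lemma tensor_assoc_linear (K : comNzRingType) (U V W : lmodType K) :
  linear (@tensor_assoc K U V W).
Proof.
have tl (X Y : lmodType K) := (tens_bilinear X Y).1.
have tr (X Y : lmodType K) := (tens_bilinear X Y).2.
have bil w0 : bilinear_map (fun (u : U) (v : V) => tens u (tens v (w0 : W))).
  split=> [v0 a u0 u1|u0 a v0 v1] /=; first exact: tl.
  by rewrite tl tr.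
apply: tlift_linear; set h := (fun _ _ => _).
have lh w0 : linear (h^~ w0) by apply: tlift_linear; apply: bil.
have hE u0 v0 w0 : h (tens u0 v0) w0 = tens u0 (tens v0 w0).
  by apply: tlift_tens; apply: bil.
(* Linearity in the last factor concerns a lifted map, hence is checked on pure tensors [t]. *)
split=> // t a w0 w1; move: t.
apply: eq_tensor; [exact: lh|by apply: linear_comb; apply: lh|].
by move=> u0 v0; rewrite !hE tr tr.
Qed.

(** * The antipode reverses products *)

Section Antipode.
Context {K : comNzRingType} {H : pzAlgType K}.
Variables (Delta : H -> tensor H H) (eps : H -> K) (S : H -> H).
Hypothesis hopf : is_hopf Delta eps S.

Let lS : linear S := antipode_linear hopf.
Let leps : scalar eps := counit_linear hopf.
Let lDelta : linear Delta := comul_linear hopf.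

Lemma mul_bilinear (f g : H -> H) :
  linear f -> linear g -> bilinear_map (fun a b : H => f a * g b).
Proof.
move=> lf lg; split=> [b k x y|a k x y].
  by rewrite lf mulrDl pz_scalerAl.
by rewrite lg mulrDr pz_scalerAr.
Qed.

(* Cancelling [id] in a convolution product: [g = (g * id) * S]. *)
Lemma convolution_id_antipode (g : H -> H) (a : H) : linear g ->
  (forall x, tlift (fun y z => g y * z) (Delta x) = eps x *: a) ->
  forall x, g x = a * S x.
Proof.
move=> lg gid x.
have bgi := mul_bilinear lg (@linear_id _ H).
have biS := mul_bilinear (@linear_id _ H) lS.
pose m := tlift (fun y z : H => y * S z).
have lm : linear m := tlift_linear biS.
(* [L] multiplies out [g * id * S] on a threefold tensor. The two sides of coassociativity at [x]
   are evaluated under [L]: one gives [a * S x], the other [g x]. *)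
pose L := tlift (fun y (t : tensor H H) => g y * m t).
have bL : bilinear_map (fun y (t : tensor H H) => g y * m t).
  split=> [t k y z|y k t u]; first by rewrite lg mulrDl pz_scalerAl.
  by rewrite lm mulrDr pz_scalerAr.
have lL : linear L := tlift_linear bL.
have lA := @tensor_assoc_linear K H H H.
have bDi := tensor_map_bilinear lDelta (@linear_id _ H).
have biD := tensor_map_bilinear (@linear_id _ H) lDelta.
have LA s b : L (tensor_assoc (tens s b)) = tlift (fun y z => g y * z) s * S b.
  move: s; apply: eq_tensor.
  - apply: linear_comp lL _; apply: linear_comp lA _.
    exact: (tens_bilinear _ _).1.
  - exact: (linear_comp (@mulr_linear _ _ _) (tlift_linear bgi)).
  - move=> u v; rewrite tensor_assocE /L (tlift_tens bL) /m (tlift_tens biS).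
    by rewrite (tlift_tens bgi) mulrA.
have bl : bilinear_map (fun y z : H => eps y *: z).
  split=> [b k y z|b k y z]; first by rewrite leps scalerDl scalerA.
  by rewrite scalerDr !scalerA mulrC.
have br : bilinear_map (fun y z : H => eps z *: y).
  split=> [b k y z|b k y z]; last by rewrite leps scalerDl scalerA.
  by rewrite scalerDr !scalerA mulrC.
(* Bracketed to the left, the convolution [g * id] collapses by [gid]. *)
have left_side t : L (tensor_assoc (tensor_map Delta id t))
    = a * S (tlift (fun y z : H => eps y *: z) t).
  move: t; apply: eq_tensor.
  - apply: linear_comp lL _; apply: linear_comp lA _; exact: tlift_linear.
  - apply: linear_comp (mull_linear a) _; apply: linear_comp lS _.
    exact: tlift_linear.
  - move=> u v; rewrite /tensor_map (tlift_tens bDi) LA gid (tlift_tens bl).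
    by rewrite (linZ lS) -pz_scalerAl -pz_scalerAr.
(* Bracketed to the right, [id * S] collapses by the antipode axiom. *)
have right_side t : L (tensor_map id Delta t)
    = g (tlift (fun y z : H => eps z *: y) t).
  move: t; apply: eq_tensor.
  - apply: linear_comp lL _; exact: tlift_linear.
  - apply: linear_comp lg _; exact: tlift_linear.
  - move=> u v; rewrite /tensor_map (tlift_tens biD) /L (tlift_tens bL).
    by rewrite /m (antipoder hopf) (tlift_tens br) (linZ lg) -pz_scalerAr mulr1.
by rewrite -{1}(counitr hopf x) -right_side -(coassociative hopf) left_side
  (counitl hopf).
Qed.

(* Two cancellations: [S (x1 y1) x2 y2 = eps x eps y] gives first
   [S (x1 y) x2 = eps x S y] and then the claim. *)
Lemma antipode_antimorphism x y : S (x * y) = S y * S x.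
Proof.
have bS z : bilinear_map (fun x1 x2 : H => S (x1 * z) * x2).
  apply: (mul_bilinear _ (@linear_id _ H)).
  exact: (linear_comp lS (@mulr_linear _ _ z)).
have bSi := mul_bilinear lS (@linear_id _ H).
have lin_g s : linear (fun z => tlift (fun x1 x2 : H => S (x1 * z) * x2) s).
  move=> k z z'; move: s; apply: eq_tensor; first exact: tlift_linear.
    by apply: linear_comb; apply: tlift_linear.
  move=> u v; rewrite !(tlift_tens (bS _)) mulrDr -pz_scalerAr lS mulrDl.
  by rewrite pz_scalerAl.
(* The iterated expression is the lift of [S u * v] at a product in the tensor algebra; as [Delta]
   is multiplicative, the antipode axiom for a product will apply to it. *)
have mulE s t :
    tlift (fun y1 y2 => tlift (fun x1 x2 : H => S (x1 * y1) * x2) s * y2) t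
    = tlift (fun u v : H => S u * v) (s * t).
  have bt s' := mul_bilinear (lin_g s') (@linear_id _ H).
  move: t; apply: eq_tensor; first exact: tlift_linear (bt s).
    exact: (linear_comp (tlift_linear bSi) (mull_linear s)).
  move=> y1 y2; rewrite (tlift_tens (bt s)); move: s; apply: eq_tensor.
  - exact: (linear_comp (@mulr_linear _ _ y2) (tlift_linear (bS y1))).
  - exact: (linear_comp (tlift_linear bSi) (@mulr_linear _ _ (tens y1 y2))).
  - by move=> x1 x2; rewrite tensM (tlift_tens (bS _)) (tlift_tens bSi) mulrA.
have [_ DM] := comul_monoid hopf; have [_ eM] := counit_monoid hopf.
(* Cancellation in the variable [x], with [a := S y]. *)
apply: (convolution_id_antipode (g := fun x => S (x * y))) => [|{}x].
  exact: (linear_comp lS (@mulr_linear _ _ y)).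
(* Cancellation in the second variable, with [Delta x] held fixed. *)
rewrite (convolution_id_antipode (a := eps x *: (1 : H)) (lin_g (Delta x))) => [|z].
  by rewrite -pz_scalerAl mul1r.
by rewrite mulE -DM (antipodel hopf) eM scalerA mulrC.
Qed.
End Antipode.

(** * The kernel of the projection *)

Section CentrificationKernel.
Context {K : comNzRingType} {I : choiceType} {J : Type}.
Variables (J0 : set J) (R : J -> free_alg K I).
Local Notation pi := (centrification_map J0 R).
Local Notation q := (aq (hopf_relators J0 R)).

Lemma centrification_ker_ideal : two_sided_ideal [set x | pi x = 0].
Proof.
have [_ piM] := centrification_map_monoid J0 R.
split; first exact: (subspace_preimage (@centrification_map_linear _ _ _ J0 R) subspace0).
  by move=> a x /= px; rewrite piM px mulr0.
by move=> a x /= px; rewrite piM px mul0r.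
Qed.

(** Pulled back to the free algebra, [Q] is an ideal containing every relator of the centrification:
    the commutators by hypothesis, the others because they already vanish in [base_alg]. *)
Lemma centrification_ker_min (Q : set (base_alg J0 R)) : two_sided_ideal Q ->
  (forall i j, J0 j -> Q (q (gen i) * q (R j) - q (R j) * q (gen i))) ->
  [set x | pi x = 0] `<=` Q.
Proof.
move=> [subQ Ql Qr] Qcomm.
have lq : linear q by move=> k u v; rewrite aqD aqZ.
suff sub : ideal_gen (centrification_relators J0 R) `<=` q @^-1` Q.
  move=> x /=; rewrite -[x]areprK centrification_map_aq => /aq_eq0.
  exact: sub.
apply: ideal_gen_min.
  split; first exact: subspace_preimage.
    by move=> u v /= Qv; rewrite aqM; apply: Ql.
  by move=> u v /= Qv; rewrite aqM; apply: Qr.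
move=> x [[i [j [Jj ->]]]|Rj] /=.
  by rewrite (linB lq) !aqM; apply: Qcomm.
have -> : q x = 0 by apply/aq_eq0; exact: (sub_ideal_gen Rj).
by case: subQ.
Qed.
End CentrificationKernel.

Theorem theorem2p4 (K : fieldType) (I : choiceType) (J : Type) (J0 : set J)
  (R : J -> free_alg K I)
  (Delta : base_alg J0 R -> tensor (base_alg J0 R) (base_alg J0 R))
  (eps : base_alg J0 R -> K)
  (S : base_alg J0 R -> base_alg J0 R)
  (hopf : is_hopf Delta eps S)
  (Delta_central : forall j, J0 j ->
     tensor_sub (centrification_map J0 R @^-1` center)
                (centrification_map J0 R @^-1` center)
                (Delta (aq (hopf_relators J0 R) (R j))))
  (S_central : forall j, J0 j ->
     (centrification_map J0 R @^-1` center) (S (aq (hopf_relators J0 R) (R j)))) :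
  is_hopf_ideal Delta eps S [set x | centrification_map J0 R x = 0].
Proof.
have lD := comul_linear hopf; have [_ DM] := comul_monoid hopf.
have leps := counit_linear hopf; have [_ epsM] := counit_monoid hopf.
have lS := antipode_linear hopf; have SM := antipode_antimorphism hopf.
have lpi := @centrification_map_linear _ _ _ J0 R.
have pi_mor := centrification_map_monoid J0 R.
have idP := centrification_ker_ideal J0 R.
have [subP Pl Pr] := idP.
have pi_comm c x : (centrification_map J0 R @^-1` center) c ->
    centrification_map J0 R (x * c - c * x) = 0.
  exact: center_commutator.
split=> //.
- set N := set_sum (tensor_sub [set x | centrification_map J0 R x = 0] setT)
    (tensor_sub setT [set x | centrification_map J0 R x = 0]).
  have [subN Nl Nr] : two_sided_ideal N.
    by apply: two_sided_ideal_sum; apply: tensor_sub_ideal.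
  apply: (centrification_ker_min (Q := Delta @^-1` N)).
    split; first exact: subspace_preimage.
      by move=> a x /= Nx; rewrite DM; apply: Nl.
    by move=> a x /= Nx; rewrite DM; apply: Nr.
  move=> i j Jj /=; rewrite (linB lD) !DM.
  by apply: (tensor_commutator idP pi_comm); apply: Delta_central.
- apply: (centrification_ker_min (Q := [set x | eps x = 0])).
    (* [K^o] is [K] as a module over itself, which makes the scalar form [eps] a linear map. *)
    split; first exact: (subspace_preimage (V := K^o) leps subspace0).
      by move=> a x /= ex; rewrite epsM ex mulr0.
    by move=> a x /= ex; rewrite epsM ex mul0r.
  by move=> i j _ /=; rewrite (linB (V := K^o) leps) !epsM mulrC subrr.
- apply: (centrification_ker_min (Q := [set x | centrification_map J0 R (S x) = 0])).
    split; first exact: (subspace_preimage lS subP).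
      (* As [S] reverses products, left absorption comes from right absorption in the kernel, and
         conversely. *)
      by move=> a x /= Px; rewrite SM; apply: Pr.
    by move=> a x /= Px; rewrite SM; apply: Pl.
  (* The reversal also flips the sign of the commutator; the scalar [-1] is pulled out to match
     [pi_comm]. *)
  move=> i j Jj /=; rewrite (linB lS) !SM -opprB -scaleN1r (linZ lpi).
  by rewrite pi_comm ?scaler0 //; apply: S_central.
Qed.
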